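(* Let $\epsilon>0$ be the threshold used in the control function $C_1$. The solution $(s_n)$ of the balanced implicit method with the control functions $C_0\ge\lambda$, $C_1$, $C_2\ge\delta$ described in the context is $\epsilon$-life time, that is, for every $n\ge 0$, $$P\big(s_{n+1}\ge 0\ \big|\ s_n\ge\epsilon,\ s_{n-m}\ge 0\big)=1 .$$
   Context: Let $(\Omega,\mathcal F,P)$ be a complete probability space with a right-continuous filtration $\{\mathcal F_t\}_{t\ge0}$ such that $\mathcal F_0$ contains all $P$-null sets. Let $W$ be a standard Brownian motion and $N$ a Poisson process with intensity $\beta>0$ with respect to this filtration, and let $\tilde N(t)=N(t)-\beta t$. Let $\gamma,\lambda,\mu,\sigma,\tau>0$ and $\delta\ge 0$ be constants. The delay CIR model with jump is $$dS(t)=\lambda(\mu-S(t))\,dt+\sigma S(t-\tau)^{\gamma}\sqrt{S(t)}\,dW(t)+\delta S(t)\,d\tilde N(t),\ t\ge0,\qquad S(t)=\xi(t),\ t\in[-\tau,0],$$ where $\xi$ is an $\mathcal F_0$-measurable positive $C([-\tau,0];\mathbb R^+)$-valued random variable with $E[\sup_{-\tau\le t\le0}|\xi(t)|^p]<\infty$ for every $p>0$. Balanced implicit method (BIM): let $h=\tau/m\in(0,1)$ with $m$ a positive integer, $t_n=nh$, $\Delta W_n=W(t_{n+1})-W(t_n)$, $\Delta\tilde N_n=\tilde N(t_{n+1})-\tilde N(t_n)$. Set $s_n=\xi(t_n)$ for $n=-m,\dots,0$, and for $n\ge0$ $$s_{n+1}=s_n+\lambda(\mu-s_n)h+\sigma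 s_{n-m}^{\gamma}\sqrt{s_n}\,\Delta W_n+\delta s_n\Delta\tilde N_n+C_n(s_n-s_{n+1}),$$ where $C_n=C_0h+C_1(s_n,s_{n-m})|\Delta W_n|+C_2|\Delta\tilde N_n|$. Here $C_0\ge\lambda$ and $C_2\ge\delta$ are positive constants and, for a fixed $\epsilon>0$, $$C_1(s_n,s_{n-m})=\begin{cases}\sigma s_{n-m}^{\gamma}\epsilon^{-1/2}, & s_n<\epsilon,\\ \sigma s_{n-m}^{\gamma}/\sqrt{s_n}, & s_n\ge\epsilon.\end{cases}$$ When the argument $x$ is negative, $x^\gamma$ and $\sqrt{x}$ are read as $|x|^\gamma$ and $\sqrt{|x|}$. The conditional probability statement means that the event $\{s_n\ge\epsilon,\ s_{n-m}\ge0,\ s_{n+1}<0\}$ has probability zero. *)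

(* Defs.v *)
From HB Require Import structures.
From mathcomp Require Import all_boot all_order all_algebra.
From mathcomp Require Import all_classical all_reals all_analysis.

Set Implicit Arguments.
Unset Strict Implicit.
Unset Printing Implicit Defensive.

Import Order.TTheory GRing.Theory Num.Theory.
Import numFieldNormedType.Exports.

Local Open Scope classical_set_scope.
Local Open Scope ring_scope.

(* Time is modelled by R : realType; processes and
   filtrations are functions on all of R of which only the values at times
   t >= 0 are constrained or used. *)

Section FilteredSpace.
Context {d : measure_display} {T : measurableType d} {R : realType}.

Record usual_filtration (P : probability T R) (F : R -> set (set T)) : Prop := {
  filt_sigma_algebra : forall t, 0 <= t -> sigma_algebra [set: T] (F t);
  filt_measurable : forall t, 0 <= t -> F t `<=` measurable;
  filt_mono : forall s t, 0 <= s -> s <= t -> F s `<=` F t;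
  filt_right_continuous : forall t, 0 <= t ->
    \bigcap_(u in [set u | t < u]) F u `<=` F t;
  filt_null : P.-negligible `<=` F 0 }.

Definition measurable_wrt (G : set (set T)) (X : T -> R) : Prop :=
  forall B : set R, measurable B -> G (X @^-1` B).

Definition independent_of (P : probability T R) (G : set (set T)) (X : T -> R)
    : Prop :=
  forall (A : set T) (B : set R), G A -> measurable B ->
    (P (A `&` X @^-1` B) = P A * P (X @^-1` B))%E.

(* The second parameter of normal_prob is the standard deviation. *)
Record brownian_motion (P : probability T R) (F : R -> set (set T))
    (W : R -> T -> R) : Prop := {
  bm_adapted : forall t, 0 <= t -> measurable_wrt (F t) (W t);
  bm_start : {ae P, forall w, W 0 w = 0};
  bm_continuous :
    {ae P, forall w, {within `[0, +oo[, continuous (fun t => W t w)}};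
  bm_independent : forall s t, 0 <= s -> s < t ->
    independent_of P (F s) (fun w => W t w - W s w);
  bm_gaussian : forall s t, 0 <= s -> s < t ->
    forall B : set R, measurable B ->
      P [set w | B (W t w - W s w)] = normal_prob 0 (Num.sqrt (t - s)) B }.

(* Left limits come for free: the paths are nondecreasing. *)
Record poisson_process (P : probability T R) (F : R -> set (set T))
    (beta : R) (N : R -> T -> nat) : Prop := {
  pp_adapted : forall t, 0 <= t -> measurable_wrt (F t) (fun w => (N t w)%:R);
  pp_start : {ae P, forall w, N 0 w = 0%N};
  pp_nondecreasing :
    {ae P, forall w, forall s t, 0 <= s -> s <= t -> (N s w <= N t w)%N};
  pp_right_continuous : {ae P, forall w, forall t, 0 <= t ->
    (N u w)%:R @[u --> t^'+] --> ((N t w)%:R : R)};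
  pp_independent : forall s t, 0 <= s -> s < t ->
    independent_of P (F s) (fun w => (N t w)%:R - (N s w)%:R);
  pp_poisson : forall s t, 0 <= s -> s < t -> forall k : nat,
    P [set w | N t w = (N s w + k)%N] = (poisson_pmf (beta * (t - s)) k)%:E }.

Definition compensated (beta : R) (N : R -> T -> nat) (t : R) (w : T) : R :=
  (N t w)%:R - beta * t.

(* Measurability of xi is Borel measurability for the topology of uniform
   convergence on [-tau, 0]; on paths continuous there, this is the sup-norm
   topology of C([-tau, 0]). *)
Record initial_segment (P : probability T R) (F0 : set (set T)) (tau : R)
    (xi : T -> R -> R) : Prop := {
  init_continuous : forall w, {within `[- tau, 0], continuous (xi w)};
  init_positive : forall w t, t \in `[- tau, 0] -> 0 < xi w t;
  init_measurable : forall U : set {uniform` `[- tau, 0]%classic -> R},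
    open U -> F0 [set w | U (xi w)];
  init_moments : forall p : R, 0 < p ->
    ('E_P[fun w => (sup [set `|xi w t| `^ p | t in `[- tau, 0]%classic])%R]
       < +oo)%E }.

End FilteredSpace.

Section BalancedImplicitMethod.
Context {R : realType}.

(* x^gamma and sqrt x are read through |x|, as x may be negative. *)
Definition abs_pow (x gamma : R) : R := `|x| `^ gamma.
Definition abs_sqrt (x : R) : R := Num.sqrt `|x|.

Definition control1 (sigma gamma eps x y : R) : R :=
  if x < eps then sigma * abs_pow y gamma * eps `^ (- 2^-1)
  else sigma * abs_pow y gamma / abs_sqrt x.

Definition control (sigma gamma eps C0 C2 h x y dW dN : R) : R :=
  C0 * h + control1 sigma gamma eps x y * `|dW| + C2 * `|dN|.

(* Nt is the compensated Poisson process; s is indexed by n >= -m. *)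
Record bim_solution {T : Type} (lambda mu sigma gamma delta eps C0 C2 h : R)
    (m : nat) (xi : T -> R -> R) (W Nt : R -> T -> R) (s : int -> T -> R)
    : Prop := {
  bim_init : forall (n : int) (w : T), - m%:Z <= n <= 0 ->
    s n w = xi w (n%:~R * h);
  bim_step : forall (n : nat) (w : T),
    let x := s n%:Z w in
    let y := s (n%:Z - m%:Z) w in
    let x' := s n.+1%:Z w in
    let dW := W (n.+1%:R * h) w - W (n%:R * h) w in
    let dN := Nt (n.+1%:R * h) w - Nt (n%:R * h) w in
    x' = x + lambda * (mu - x) * h
         + sigma * abs_pow y gamma * abs_sqrt x * dW
         + delta * x * dN
         + control sigma gamma eps C0 C2 h x y dW dN * (x - x') }.

(* P(s_{n+1} >= 0 | s_n >= eps, s_{n-m} >= 0) = 1, in the sense that the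
   conditioning event meets {s_{n+1} < 0} in an event of probability zero. *)
Definition eps_life_time {d : measure_display} {T : measurableType d}
    (P : probability T R) (m : nat) (eps : R) (s : int -> T -> R) : Prop :=
  forall n : nat,
    P [set w | [/\ eps <= s n%:Z w, 0 <= s (n%:Z - m%:Z) w
                 & s n.+1%:Z w < 0]] = 0%E.

End BalancedImplicitMethod.

(* Main.v *)
Require Import Defs.
From HB Require Import structures.
From mathcomp Require Import all_boot all_order all_algebra.
From mathcomp Require Import all_classical all_reals all_analysis.
From mathcomp Require Import ring.
Import Order.TTheory GRing.Theory Num.Theory.
Import numFieldNormedType.Exports.
Local Open Scope classical_set_scope.
Local Open Scope ring_scope.

(** The property is pathwise: on every trajectory [eps <= s_n] forces
    [0 <= s_(n+1)], so the event in question is empty. Solving the implicit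
    step for [s_(n+1)] gives, with [x = s_n] and [a = sigma * |s_(n-m)| ^ gamma],
<<
      (1 + C_n) s_(n+1) = x + lambda (mu - x) h + a sqrt x dW + delta x dN
                          + C_n x.
>>
    For [x >= eps] the three terms of [C_n x] are [C0 h x], [a sqrt x |dW|] and
    [C2 x |dN|]; they dominate the negative parts of the drift, of the diffusion
    and of the jump respectively. The right-hand side is thus at least
    [x + lambda mu h > 0], while [1 + C_n > 0]. *)

Section Step.
Set Implicit Arguments.
Unset Strict Implicit.
Context {R : realType}.
Implicit Types (x y dW dN : R).

Lemma control1_ge0 (sigma gamma eps x y : R) :
  0 <= sigma -> 0 <= control1 sigma gamma eps x y.
Proof.
move=> sigma_ge0; rewrite /control1 /abs_pow /abs_sqrt.
by case: ifP => _; rewrite !mulr_ge0 ?invr_ge0 ?sqrtr_ge0 ?powR_ge0.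
Qed.

(** The control is chosen so that, above the threshold, multiplying it by the
    state gives back the diffusion coefficient. *)
Lemma control1_mul (sigma gamma eps x y : R) : 0 < eps -> eps <= x ->
  control1 sigma gamma eps x y * x = sigma * abs_pow y gamma * abs_sqrt x.
Proof.
move=> eps_gt0 eps_le; have x_gt0 : 0 < x := lt_le_trans eps_gt0 eps_le.
rewrite /control1 ltNge eps_le /= /abs_sqrt gtr0_norm//.
by rewrite -{2}(sqr_sqrtr (ltW x_gt0)) expr2 mulrA divfK// gt_eqF// sqrtr_gt0.
Qed.

Lemma control_ge0 (sigma gamma eps C0 C2 h x y dW dN : R) :
  0 <= sigma -> 0 <= C0 -> 0 <= C2 -> 0 <= h ->
  0 <= control sigma gamma eps C0 C2 h x y dW dN.
Proof. by move=> *; rewrite !addr_ge0 ?mulr_ge0 ?control1_ge0. Qed.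

Lemma addr_mul_norm_ge0 (a b u : R) : 0 <= a -> a <= b -> 0 <= a * u + b * `|u|.
Proof.
move=> a_ge0 ab; rewrite -[X in 0 <= X + _]opprK addrC subr_ge0 -mulrN.
rewrite (@le_trans _ _ (a * `|u|))//; last by rewrite ler_wpM2r.
by rewrite ler_wpM2l// -normrN ler_norm.
Qed.

(** The step only enters through its linear equation in [x'], so the increments
    [dW] and [dN] are arbitrary reals here. *)
Lemma bim_step_ge0
    (lambda mu sigma gamma delta eps C0 C2 h x y x' dW dN : R) :
  0 <= lambda -> 0 <= mu -> 0 <= sigma -> 0 <= delta -> 0 < eps -> 0 <= h ->
  lambda <= C0 -> delta <= C2 -> eps <= x ->
  x' = x + lambda * (mu - x) * h + sigma * abs_pow y gamma * abs_sqrt x * dW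
       + delta * x * dN
       + control sigma gamma eps C0 C2 h x y dW dN * (x - x') ->
  0 <= x'.
Proof.
move=> lambda_ge0 mu_ge0 sigma_ge0 delta_ge0 eps_gt0 h_ge0 lambda_le delta_le.
move=> eps_le step; have x_gt0 : 0 < x := lt_le_trans eps_gt0 eps_le.
have := control_ge0 gamma eps x y dW dN sigma_ge0 (le_trans lambda_ge0 lambda_le)
  (le_trans delta_ge0 delta_le) h_ge0.
have := control1_mul sigma gamma y eps_gt0 eps_le.
move: step; rewrite /control; set a := sigma * _ * _; set c1 := control1 _ _ _ _ _.
set c := _ + C2 * _ => step c1x c_ge0.
have c1_ge0 : 0 <= c1 by exact: control1_ge0.
have diffusion : 0 <= a * dW + a * `|dW|.
  by rewrite addr_mul_norm_ge0// -c1x mulr_ge0// ltW.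
have jump := addr_mul_norm_ge0 dN delta_ge0 delta_le.
have drift : 0 <= (C0 - lambda) * h * x.
  by rewrite !mulr_ge0 ?subr_ge0// ltW.
have mean : 0 <= lambda * mu * h by rewrite !mulr_ge0.
have solved : (1 + c) * x' = x + lambda * mu * h + (C0 - lambda) * h * x
    + (a * dW + a * `|dW|) + x * (delta * dN + C2 * `|dN|).
  transitivity (x' + c * x'); first by ring.
  rewrite {1}step /c -c1x; ring.
rewrite -(@pmulr_rge0 _ (1 + c)) ?ltr_pwDl// solved.
have x_ge0 := ltW x_gt0.
by do 4?apply: addr_ge0 => //; apply: mulr_ge0.
Qed.

End Step.

Theorem theorem2p3 (d : measure_display) (T : measurableType d) (R : realType)
    (P : probability T R) (F : R -> set (set T))
    (W : R -> T -> R) (N : R -> T -> nat) (xi : T -> R -> R)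
    (beta gamma lambda mu sigma tau delta eps C0 C2 h : R) (m : nat)
    (s : int -> T -> R)
    (Pcomplete : measure_is_complete P)
    (Ffilt : usual_filtration P F)
    (beta_gt0 : 0 < beta) (gamma_gt0 : 0 < gamma) (lambda_gt0 : 0 < lambda)
    (mu_gt0 : 0 < mu) (sigma_gt0 : 0 < sigma) (tau_gt0 : 0 < tau)
    (delta_ge0 : 0 <= delta) (eps_gt0 : 0 < eps)
    (W_bm : brownian_motion P F W)
    (N_pp : poisson_process P F beta N)
    (xi_init : initial_segment P (F 0) tau xi)
    (m_gt0 : (0 < m)%N) (h_def : h = tau / m%:R) (h_gt0 : 0 < h) (h_lt1 : h < 1)
    (C0_gt0 : 0 < C0) (C0_ge : lambda <= C0)
    (C2_gt0 : 0 < C2) (C2_ge : delta <= C2)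
    (s_bim : bim_solution lambda mu sigma gamma delta eps C0 C2 h m xi
               W (compensated beta N) s) :
  eps_life_time P m eps s.
Proof.
move=> n; rewrite [X in P X](_ : _ = set0) ?measure0//.
apply/seteqP; split=> // w [eps_le _]; rewrite ltNge => /negP; apply.
exact: (bim_step_ge0 (ltW lambda_gt0) (ltW mu_gt0) (ltW sigma_gt0) delta_ge0
  eps_gt0 (ltW h_gt0) C0_ge C2_ge eps_le (bim_step s_bim n w)).
Qed.
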